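(* For a positive integer $k$, let $m_k$ denote the minimum order of a connected graph $G$ with $c(G)\geq k$. Then: (1) $m_k = O(k^2)$ as $k\to\infty$. (2) The following two statements are equivalent: (i) (Meyniel's conjecture) there is a constant $d>0$ such that every connected graph $G$ of order $n$ satisfies $c(G)\leq d\sqrt{n}$; (ii) $m_k=\Omega(k^2)$ as $k\to\infty$.
   Context: Cops and Robbers is played on a finite, connected, undirected graph $G$. Cops first each choose a starting vertex, then the robber does; thereafter players alternate rounds, cops first, each player moving to an adjacent vertex or staying put (several cops may share a vertex). The cops win if some cop eventually occupies the robber's vertex. The cop number $c(G)$ is the minimum number of cops that have a winning strategy. *)

(* Defs.v *)
From HB Require Import structures.
From mathcomp Require Import all_boot all_order all_algebra.
From mathcomp Require Import boolp classical_sets reals topology normedtype landau.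

Set Implicit Arguments.
Unset Strict Implicit.
Unset Printing Implicit Defensive.

Import Order.TTheory GRing.Theory Num.Theory.
Import numFieldNormedType.Exports.

Record graph := Graph {
  vertex :> finType;
  adj : rel vertex;
  adj_sym : symmetric adj;
  adj_irr : irreflexive adj
}.

Definition graph_order (G : graph) : nat := #|vertex G|.

Definition connected_graph (G : graph) : Prop :=
  0 < graph_order G /\ forall x y : G, connect (@adj G) x y.

Definition legal_move (G : graph) (x y : G) : Prop := x = y \/ adj x y.

(* A strategy of [k] cops maps the list of the robber's positions so far, in
   chronological order, to the current positions of the cops: [s [::]] is the
   initial placement, chosen before the robber's, and [s [:: r_0; ...; r_t]] is
   the position of the cops after their answer to the robber being at [r_t]. *)
Definition cop_strategy (G : graph) (k : nat) := seq G -> 'I_k -> G.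

Definition legal_strategy (G : graph) (k : nat) (s : cop_strategy G k) : Prop :=
  forall (h : seq G) (x : G) (i : 'I_k), legal_move (s h i) (s (rcons h x) i).

Definition robber_play (G : graph) (r : nat -> G) : Prop :=
  forall t, legal_move (r t) (r t.+1).

(* The two cases are a meeting right after the robber's arrival at [r t], and
   right after the answer of the cops. *)
Definition captures (G : graph) (k : nat) (s : cop_strategy G k)
    (r : nat -> G) : Prop :=
  exists (t : nat) (i : 'I_k),
    s (mkseq r t) i = r t \/ s (mkseq r t.+1) i = r t.

Definition cops_win (G : graph) (k : nat) : Prop :=
  exists s : cop_strategy G k,
    legal_strategy s /\ forall r, robber_play r -> captures s r.

Lemma cops_win_order (G : graph) : cops_win G (graph_order G).
Proof.
exists (fun _ => @enum_val G (mem predT)); split=> [h x i|r _]; first by left.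
by exists 0, (enum_rank (r 0)); left; rewrite enum_rankK.
Qed.

Lemma ex_cops_win (G : graph) : exists k, `[< cops_win G k >].
Proof. by exists (graph_order G); apply/asboolP; apply: cops_win_order. Qed.

Definition cop_number (G : graph) : nat := ex_minn (ex_cops_win G).

Definition is_min_order (k n : nat) : Prop :=
  (exists G : graph, [/\ connected_graph G, k <= cop_number G & graph_order G = n]) /\
  (forall G : graph, connected_graph G -> k <= cop_number G -> n <= graph_order G).

(* Meaningful only together with [is_min_order k (min_order k)]: the default
   value is [0] if no connected graph has cop number at least [k]. *)
Definition min_order (k : nat) : nat := xget 0 [set n | is_min_order k n]%classic.

Local Open Scope ring_scope.

Definition meyniel_conjecture (R : realType) : Prop :=
  exists2 d : R, 0 < d &
    forall G : graph, connected_graph G ->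
      (cop_number G)%:R <= d * Num.sqrt (graph_order G)%:R.

(* Main.v *)
Require Import Defs.
From mathcomp Require Import all_boot all_order all_algebra.
From mathcomp Require Import finfield ring.
From mathcomp Require Import boolp classical_sets reals topology normedtype landau.

(** In a graph without cycles of length 3 or 4, the closed neighbourhood of a
    vertex [c <> u] contains at most one neighbour of [u].  Fewer cops than the
    minimum degree therefore always leave the robber a neighbour that no cop can
    reach in one move, so the cop number is at least the minimum degree.  The
    incidence graph of the points and the non-vertical lines of the affine plane
    over the field with [q] elements is connected, [q]-regular, without such
    cycles, and has [2 q^2] vertices; taking for [q] a power of two with
    [k < q <= 2 k] gives [m_k <= 8 k^2].

    Any bound [phi (c G) <= psi (order G)] with monotone [phi] and [psi] amounts
    to [phi k <= psi m_k] for all [k].  Meyniel's conjecture thus becomes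
    [k <= d sqrt m_k], that is [k^2 <= d^2 m_k], and since [m_k] never vanishes
    it is enough to have such a bound for large [k]. *)

Set Implicit Arguments.
Unset Strict Implicit.
Unset Printing Implicit Defensive.

Import Order.TTheory GRing.Theory Num.Theory.
Import numFieldNormedType.Exports.

Lemma exists_uncovered (T I : finType) (A : {set T}) (B : I -> {set T}) m :
  (forall i, #|A :&: B i| <= m) -> #|I| * m < #|A| ->
  exists2 x, x \in A & forall i, x \notin B i.
Proof.
move=> leBm ltA.
suff /subsetPn[x xA /finset.bigcupP xB] : ~~ (A \subset \bigcup_i B i).
  by exists x => // i; apply/negP => xBi; apply: xB; exists i.
apply: contraL ltA => /finset.setIidPl <-.
rewrite -leqNgt big_distrr /= -sum_nat_const.
elim/big_ind2: _ => [|a A1 b A2 leA1 leA2|i _]; rewrite ?cards0 //.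
exact: leq_trans (leq_card_setU _ _) (leq_add leA1 leA2).
Qed.

Lemma exists_course_of_values (T : Type) (f : seq T -> T) :
  exists r : nat -> T, forall t, r t = f (mkseq r t).
Proof.
pose fix h t := if t is t'.+1 then rcons (h t') (f (h t')) else [::].
exists (f \o h) => t; congr f.
by elim: t => // t IH; rewrite mkseqS -IH.
Qed.

Section Neighbourhoods.
Variable G : graph.

Definition neighbourhood (u : G) : {set G} := [set v | adj u v].

Definition closed_neighbourhood (u : G) : {set G} := u |: neighbourhood u.

Lemma closed_neighbourhoodP (u v : G) :
  reflect (legal_move u v) (v \in closed_neighbourhood u).
Proof.
rewrite !inE eq_sym.
by apply: (iffP orP) => -[/eqP|] ?; [left|right|left|right].
Qed.

Definition overlaps_le (m : nat) : Prop :=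
  forall u c : G, c != u -> #|neighbourhood u :&: closed_neighbourhood c| <= m.

Definition triangle_free : Prop :=
  forall x y z : G, adj x y -> adj y z -> adj x z -> False.

Definition square_free : Prop :=
  forall x y u v : G, adj x u -> adj x v -> adj y u -> adj y v ->
    x = y \/ u = v.

Lemma overlaps_le1 : triangle_free -> square_free -> overlaps_le 1.
Proof.
move=> notri nosq u c cu; apply/card_le1_eqP => v w; rewrite !(in_setI, inE).
move=> /andP[uv /predU1P cv] /andP[uw /predU1P cw].
case: cv cw uv uw => [->|cv] [->|cw] uv uw //.
- by case: (notri u c w).
- by case: (notri u c v).
- by have [eq_uc|//] := nosq u c v w uv uw cv cw; rewrite eq_uc eqxx in cu.
Qed.

End Neighbourhoods.

Section Evasion.
Variables (G : graph) (k : nat).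

Definition unoccupied (c : 'I_k -> G) (u : G) : Prop := forall i, c i != u.

Definition unattacked (c : 'I_k -> G) (v : G) : Prop :=
  forall i, v \notin closed_neighbourhood (c i).

Definition evasive : Prop :=
  forall c u, unoccupied c u -> exists2 v, legal_move u v & unattacked c v.

Lemma exists_unoccupied (c : 'I_k -> G) :
  k < graph_order G -> exists u, unoccupied c u.
Proof.
move=> kG; suff /subsetPn[u _ uc] : ~~ ([set: G] \subset codom c).
  by exists u => i; apply: contraNneq uc => <-; apply: codom_f.
apply: contraL kG => /subset_leq_card; rewrite cardsT -leqNgt.
by move=> /leq_trans; apply; rewrite -[leqRHS]card_ord; apply: leq_image_card.
Qed.

Lemma unattacked_unoccupied (s : cop_strategy G k) (h : seq G) (v : G) :
  legal_strategy s -> unattacked (s h) v -> unoccupied (s (rcons h v)) v.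
Proof.
move=> legal safe i; apply: contra (safe i) => /eqP eq_v.
by apply/closed_neighbourhoodP; rewrite -[X in legal_move _ X]eq_v.
Qed.

Lemma evasive_robber_wins : k < graph_order G -> evasive -> ~ cops_win G k.
Proof.
move=> kG evade [s [legal win]].
have [u0 u0_free] := exists_unoccupied (s [::]) kG.
pose escapes h v := unoccupied (s h) (last u0 h) ->
  legal_move (last u0 h) v /\ unattacked (s h) v.
have /choice[escape escapeP] h : exists v, escapes h v.
  have [/evade[v] |not_free] := pselect (unoccupied (s h) (last u0 h)).
    by exists v.
  by exists u0.
(* The first position of the robber is already an escape, from the vertex [u0]
   where he is never seen. *)
have [r rE] := exists_course_of_values escape.
have lastE t : last u0 (mkseq r t.+1) = r t by rewrite mkseqS last_rcons.
have free t : unoccupied (s (mkseq r t)) (last u0 (mkseq r t)).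
  elim: t => // t /escapeP[_]; rewrite -rE lastE mkseqS.
  exact: unattacked_unoccupied.
have /win[t [i [caught|caught]]] : robber_play r.
- by move=> t; have [] := escapeP _ (free t.+1); rewrite -rE lastE.
- by have [_ /(_ i)] := escapeP _ (free t); rewrite -rE -caught setU11.
- by have := free t.+1 i; rewrite caught lastE eqxx.
Qed.

Lemma overlaps_le_evasive (m : nat) :
  overlaps_le G m -> (forall u : G, k * m < #|neighbourhood u|) -> evasive.
Proof.
move=> overlap deg c u free.
have [i||v] := @exists_uncovered _ _ (neighbourhood u)
  (fun i => closed_neighbourhood (c i)) m.
- exact: overlap.
- by rewrite card_ord.
- by rewrite inE; exists v => //; right.
Qed.

End Evasion.

Lemma cops_win_cop_number (G : graph) : cops_win G (cop_number G).
Proof. by rewrite /cop_number; case: ex_minnP => k /asboolP. Qed.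

Lemma min_degree_le_cop_number (G : graph) (m d : nat) :
  0 < m -> 0 < graph_order G -> overlaps_le G m ->
  (forall u : G, d <= #|neighbourhood u|) -> d <= cop_number G * m.
Proof.
move=> m0 /card_gt0P[u _] overlap deg; rewrite leqNgt; apply/negP => lt_d.
apply: evasive_robber_wins (cops_win_cop_number G); last first.
  by apply: overlaps_le_evasive overlap _ => v; apply: leq_trans (deg v).
apply: leq_trans (leq_trans (deg u) (max_card _)).
exact: leq_ltn_trans (leq_pmulr _ m0) lt_d.
Qed.

Definition partial_linear_space (P L : Type) (inc : P -> L -> bool) : Prop :=
  forall p p' l l', inc p l -> inc p l' -> inc p' l -> inc p' l' ->
    p = p' \/ l = l'.

Section IncidenceGraph.
Variables (P L : finType) (inc : P -> L -> bool).

Definition incidence_adj (u v : P + L) : bool :=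
  match u, v with
  | inl p, inr l | inr l, inl p => inc p l
  | _, _ => false
  end.

Lemma incidence_adj_sym : symmetric incidence_adj.
Proof. by move=> [p|l] [p'|l']. Qed.

Lemma incidence_adj_irr : irreflexive incidence_adj.
Proof. by move=> [p|l]. Qed.

Definition incidence_graph : graph := Graph incidence_adj_sym incidence_adj_irr.

Lemma incidence_graph_order : graph_order incidence_graph = #|P| + #|L|.
Proof. exact: card_sum. Qed.

Lemma incidence_graph_triangle_free : triangle_free incidence_graph.
Proof. by move=> [x|x] [y|y] [z|z]. Qed.

Lemma incidence_graph_square_free :
  partial_linear_space inc -> square_free incidence_graph.
Proof.
move=> linear [p|l] [p'|l'] [u|u] [v|v] //=.
- move=> pu pv p'u p'v.
  by have [->|->] := linear p p' u v pu pv p'u p'v; [left|right].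
- move=> ul vl ul' vl'.
  by have [->|->] := linear u v l l' ul ul' vl vl'; [right|left].
Qed.

End IncidenceGraph.

Section AffinePlane.
Local Open Scope ring_scope.

(* [l = (a, b)] stands for the line of equation [y = a x + b]. *)
Definition on_line (R : nzRingType) (p l : R * R) : bool :=
  p.2 == l.1 * p.1 + l.2.

Lemma on_line_partial_linear_space (R : idomainType) :
  partial_linear_space (@on_line R).
Proof.
move=> [x y] [x' y'] [a b] [a' b'] /eqP/= pl /eqP/= pl' /eqP/= p'l /eqP/= p'l'.
have : (a - a') * (x - x') = 0.
  have -> : (a - a') * (x - x') =
    ((a * x + b) - (a' * x + b')) - ((a * x' + b) - (a' * x' + b')) by ring.
  by rewrite -pl -pl' -p'l -p'l' !subrr.
move=> /eqP; rewrite mulf_eq0 !subr_eq0 => /orP[/eqP eq_a|/eqP eq_x].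
  by right; move: pl'; rewrite pl eq_a => /addrI ->.
by left; rewrite pl p'l eq_x.
Qed.

Variable F : finFieldType.

Definition affine_plane : graph := incidence_graph (@on_line F).

Lemma affine_plane_order : graph_order affine_plane = (2 * #|F| ^ 2)%N.
Proof. by rewrite incidence_graph_order card_prod mulnn mul2n addnn. Qed.

Lemma affine_plane_regular (u : affine_plane) : #|neighbourhood u| = #|F|.
Proof.
case: u => [[x y]|[a b]].
- pose line_of_slope a : affine_plane := inr (a, y - a * x).
  rewrite -(@card_imset _ _ line_of_slope); last by move=> ? ? [].
  apply: eq_card => -[p|[a b]]; rewrite inE; first by apply/esym/imsetP => -[].
  rewrite /= /on_line /=.
  apply/eqP/imsetP => [eq_y|[a' _ [-> ->]]]; last by rewrite addrC subrK.
  by exists a; rewrite // /line_of_slope eq_y addrC addKr.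
- pose point_of_abscissa x : affine_plane := inl (x, a * x + b).
  rewrite -(@card_imset _ _ point_of_abscissa); last by move=> ? ? [].
  apply: eq_card => -[[x y]|l]; rewrite inE; last by apply/esym/imsetP => -[].
  rewrite /= /on_line /=.
  by apply/eqP/imsetP => [->|[x' _ [-> ->]] //]; exists x.
Qed.

Lemma affine_plane_connected : connected_graph affine_plane.
Proof.
split.
  by rewrite affine_plane_order muln_gt0 expn_gt0 (ltnW (card_finNzRing_gt1 F)).
pose origin : affine_plane := inl (0, 0).
have point_off_axis x y :
    x != 0 -> connect (@adj affine_plane) (inl (x, y)) origin.
  move=> x0; apply: (@connect_trans _ _ (inr (y / x, 0))); apply: connect1.
    by rewrite /= /on_line /= addr0 divfK.
  by rewrite /= /on_line /= mulr0 addr0.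
have line a b : connect (@adj affine_plane) (inr (a, b)) origin.
  apply: connect_trans (point_off_axis 1 (a + b) (oner_neq0 _)).
  apply: connect1.
  by rewrite /= /on_line /= mulr1.
have to_origin u : connect (@adj affine_plane) u origin.
  case: u => [[x y]|[a b]]; last exact: line.
  apply: connect_trans (line 0 y); apply: connect1.
  by rewrite /= /on_line /= mul0r add0r.
move=> u v; apply: connect_trans (to_origin u) _.
by rewrite (sym_connect_sym (@adj_sym affine_plane)).
Qed.

Lemma affine_plane_cop_number : (#|F| <= cop_number affine_plane)%N.
Proof.
rewrite -[leqRHS]muln1.
apply: min_degree_le_cop_number affine_plane_connected.1 _ _ => //.
  apply: overlaps_le1; first exact: incidence_graph_triangle_free.
  exact/incidence_graph_square_free/on_line_partial_linear_space.
by move=> u; rewrite affine_plane_regular.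
Qed.

End AffinePlane.

Lemma exists_finField_card_between (p k : nat) : prime p -> 0 < k ->
  exists F : finFieldType, k < #|F| <= p * k.
Proof.
move=> p_prime k0.
have /andP[le_k lt_k] := trunc_log_bounds (prime_gt1 p_prime) k0.
have [F _ cardF] := @pPrimePowerField p (trunc_log p k).+1 p_prime isT.
by exists F; rewrite cardF lt_k expnS leq_mul2l le_k orbT.
Qed.

Lemma exists_cop_number_ge (k : nat) : 0 < k ->
  exists G : graph,
    [/\ connected_graph G, k <= cop_number G & graph_order G <= 8 * k ^ 2].
Proof.
move=> /(exists_finField_card_between (isT : prime 2))[F /andP[ltkF leF2k]].
exists (affine_plane F); split; first exact: affine_plane_connected.
  exact: leq_trans (ltnW ltkF) (affine_plane_cop_number F).
by rewrite affine_plane_order -(mulnA 2 (2 ^ 2)) -expnMn leq_mul2l leq_exp2r.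
Qed.

Lemma is_min_order_min_order (k : nat) : is_min_order k (min_order k).
Proof.
apply: xgetPex; pose realized n := `[< exists G : graph,
  [/\ connected_graph G, k <= cop_number G & graph_order G = n] >].
have /ex_minnP[n /asboolP n_realized n_min] : exists n, realized n.
  have [G [connG ltkG _]] := @exists_cop_number_ge k.+1 isT.
  by exists (graph_order G); apply/asboolP; exists G; rewrite (ltnW ltkG).
exists n; split=> // G connG lekG.
by apply: n_min; apply/asboolP; exists G.
Qed.

Lemma min_order_gt0 (k : nat) : 0 < min_order k.
Proof. by have [[G [[G0 _] _ <-]] _] := is_min_order_min_order k. Qed.

Lemma min_order_le (k : nat) : 0 < k -> min_order k <= 8 * k ^ 2.
Proof.
move=> /exists_cop_number_ge[G [connG lekG]]; apply: leq_trans.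
exact: (is_min_order_min_order k).2.
Qed.

Lemma cop_number_min_orderP (d : Order.disp_t) (T : porderType d)
    (phi psi : nat -> T) :
  {homo phi : m n / m <= n >-> (m <= n)%O} ->
  {homo psi : m n / m <= n >-> (m <= n)%O} ->
  (forall G, connected_graph G ->
     (phi (cop_number G) <= psi (graph_order G))%O) <->
  (forall k, (phi k <= psi (min_order k))%O).
Proof.
move=> phi_homo psi_homo; split=> [bound k|bound G connG].
  have [[G [connG lekG <-]] _] := is_min_order_min_order k.
  exact: le_trans (phi_homo _ _ lekG) (bound G connG).
apply: le_trans (bound _) (psi_homo _ _ _).
exact: (is_min_order_min_order _).2.
Qed.

Local Open Scope classical_set_scope.
Local Open Scope ring_scope.

Lemma eqO_oo_neq0P (K : numFieldType) (V W : normedModType K)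
    (f : nat -> V) (g : nat -> W) : (forall n, g n != 0) ->
  f =O_\oo g <-> exists2 c, 0 < c & forall n, `|f n| <= c * `|g n|.
Proof.
move=> g_neq0; rewrite eqO_exP.
split=> [[c c0 [N _ large]]|[c c0 bound]]; last by exists c => //; apply: nearW.
pose ratio n := `|f n| / `|g n|.
have ratio_ge0 n : 0 <= ratio n by rewrite divr_ge0.
exists (c + \sum_(n < N) ratio n); first by rewrite ltr_pwDl ?sumr_ge0.
move=> n; rewrite mulrDl; have [/large le_c|lt_nN] := leqP N n.
  by rewrite ler_wpDr // mulr_ge0 ?sumr_ge0.
rewrite ler_wpDl ?mulr_ge0 ?(ltW c0) // -ler_pdivrMr ?normr_gt0 //.
by rewrite (bigD1 (Ordinal lt_nN)) //= ler_wpDr ?sumr_ge0.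
Qed.

Lemma ler_mul_sqrt (R : rcfType) (a d x : R) : 0 <= a -> 0 <= d -> 0 <= x ->
  (a <= d * Num.sqrt x) = (a ^+ 2 <= d ^+ 2 * x).
Proof.
move=> a0 d0 x0; rewrite -{2}(sqr_sqrtr x0) -exprMn.
by rewrite ler_sqr // nnegrE mulr_ge0 ?sqrtr_ge0.
Qed.

Lemma meyniel_min_orderP (R : realType) :
  meyniel_conjecture R <->
  exists2 d : R, 0 < d & forall k, k%:R <= d * Num.sqrt (min_order k)%:R.
Proof.
pose bound (d : R) n := d * Num.sqrt n%:R.
have bound_homo d : 0 < d -> {homo bound d : m n / (m <= n)%N >-> m <= n}.
  by move=> d0 m n lemn; rewrite ler_pM2l // ler_wsqrtr // ler_nat.
have natr_homo : {homo (fun n => n%:R : R) : m n / (m <= n)%N >-> m <= n}.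
  by move=> m n; rewrite ler_nat.
split=> -[d d0 bounded]; exists d => //;
  exact/(cop_number_min_orderP natr_homo (bound_homo d d0)).
Qed.

Lemma min_order_eqOmegaP (R : realType) :
  (fun k : nat => (min_order k)%:R : R) =Omega_\oo
    (fun k : nat => k%:R ^+ 2 : R) <->
  exists2 c : R, 0 < c & forall k, k%:R ^+ 2 <= c * (min_order k)%:R.
Proof.
rewrite eqOmegaE eqOmegaO eqO_oo_neq0P => [|k]; last first.
  by rewrite pnatr_eq0 -lt0n min_order_gt0.
have normE k : (`|k%:R ^+ 2| = k%:R ^+ 2 :> R) * (`|k%:R| = k%:R :> R).
  by rewrite !ger0_norm ?exprn_ge0 ?ler0n.
by split=> -[c c0 bound]; exists c => // k; have := bound k; rewrite !normE.
Qed.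

Lemma min_order_eqO (R : realType) :
  (fun k : nat => (min_order k)%:R : R) =O_\oo (fun k : nat => k%:R ^+ 2 : R).
Proof.
apply/eqO_exP; exists 8 => //; exists 1%N => // k /= k0.
rewrite !ger0_norm ?exprn_ge0 ?ler0n // -natrX -natrM ler_nat.
exact: min_order_le.
Qed.

Lemma meyniel_eqOmegaP (R : realType) :
  meyniel_conjecture R <->
  (fun k : nat => (min_order k)%:R : R) =Omega_\oo (fun k : nat => k%:R ^+ 2 : R).
Proof.
rewrite meyniel_min_orderP min_order_eqOmegaP; split=> -[c c0 bound].
  exists (c ^+ 2) => [|k]; first exact: exprn_gt0.
  by rewrite -ler_mul_sqrt ?ler0n ?(ltW c0).
exists (Num.sqrt c) => [|k]; first by rewrite sqrtr_gt0.
by rewrite ler_mul_sqrt ?sqrtr_ge0 ?ler0n // sqr_sqrtr ?(ltW c0).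
Qed.

Theorem theorem3 (R : realType) :
  (forall k : nat, (0 < k)%N -> is_min_order k (min_order k)) /\
  (fun k : nat => (min_order k)%:R : R) =O_\oo (fun k : nat => k%:R ^+ 2 : R) /\
  (meyniel_conjecture R <->
    (fun k : nat => (min_order k)%:R : R) =Omega_\oo (fun k : nat => k%:R ^+ 2 : R)).
Proof.
split=> [k _|]; first exact: is_min_order_min_order.
by split; [exact: min_order_eqO | exact: meyniel_eqOmegaP].
Qed.
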